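(* Up to isomorphism, the Abelian groups of order $n$ with $1<n<100$ that induce pentagonal quasigroups are exactly $\mathbb{Z}_{5}$, $\mathbb{Z}_{11}$, $\mathbb{Z}_{2}^4$, $\mathbb{Z}_{5}^2$, $\mathbb{Z}_{31}$, $\mathbb{Z}_{41}$, $\mathbb{Z}_{55}$, $\mathbb{Z}_{61}$, $\mathbb{Z}_{71}$, $\mathbb{Z}_{2}^4\times \mathbb{Z}_{5}$ and $\mathbb{Z}_{3}^4$.
   Context: A pentagonal quasigroup is a quasigroup satisfying $xx=x$, $\;(xy)(zu)=(xz)(yu)$ and $\big(((xy)x)y\big)x=y$. An Abelian group $(Q,+)$ induces a pentagonal quasigroup $(Q,\cdot)$ if $x\cdot y=\varphi(x)+y-\varphi(y)$ for all $x,y\in Q$, where $\varphi$ is a regular automorphism of $(Q,+)$ (i.e. $\varphi(x)=x$ only for $x=0$) satisfying $\varphi^4-\varphi^3+\varphi^2-\varphi+\varepsilon=0$, with $\varepsilon$ the identity map. *)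

(* Defs.v *)
From HB Require Import structures.
From mathcomp Require Import all_boot all_order all_algebra.

Set Implicit Arguments.
Unset Strict Implicit.
Unset Printing Implicit Defensive.

Import GRing.Theory.
Local Open Scope ring_scope.

Definition quasigroup (Q : Type) (op : Q -> Q -> Q) : Prop :=
  (forall a b, exists! x, op a x = b) /\ (forall a b, exists! y, op y a = b).

Definition pentagonal_quasigroup (Q : Type) (op : Q -> Q -> Q) : Prop :=
  [/\ quasigroup op,
      forall x, op x x = x,
      forall x y z u, op (op x y) (op z u) = op (op x z) (op y u)
    & forall x y, op (op (op (op x y) x) y) x = y].

Definition regular_automorphism (Q : zmodType) (phi : {additive Q -> Q}) : Prop :=
  bijective phi /\ (forall x, phi x = x <-> x = 0).

(* The equation phi^4 - phi^3 + phi^2 - phi + id = 0 in End(Q), pointwise. *)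
Definition pentagonal_equation (Q : zmodType) (phi : {additive Q -> Q}) : Prop :=
  forall x, iter 4 phi x - iter 3 phi x + iter 2 phi x - phi x + x = 0.

Definition induces (Q : zmodType) (op : Q -> Q -> Q) : Prop :=
  exists phi : {additive Q -> Q},
    [/\ regular_automorphism phi, pentagonal_equation phi
      & forall x y, op x y = phi x + y - phi y].

Definition induces_pentagonal_quasigroup (Q : zmodType) : Prop :=
  exists op : Q -> Q -> Q, pentagonal_quasigroup op /\ induces op.

Definition isomorphic (G H : zmodType) : Prop :=
  exists f : {additive G -> H}, bijective f.

(* Main.v *)
Require Import Defs.
From HB Require Import structures.
From mathcomp Require Import all_boot all_order all_fingroup all_algebra.
From mathcomp Require Import all_solvable ring.

(** Everything rests on sigma = - phi. The equation satisfied by phi makes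
    both phi and 1 - phi invertible by explicit polynomials in phi, so that the
    quasigroup laws and regularity come for free: a group induces a pentagonal
    quasigroup as soon as it has an endomorphism that solves the equation
    ([induces_pentagonal_quasigroupP]). The same equation gives phi^5 = -1,
    that is, sigma^5 = 1, and a fixed point of sigma is killed by 5.

    Hence sigma permutes the nonzero elements of a phi-stable subgroup of order
    prime to 5 in orbits of length 5, and that order is 1 modulo 5
    ([card_stable_mod5]). For a prime p distinct from 5, apply this twice.
    On the p-primary part it says that the p-part of the order of Q is
    1 modulo 5, which leaves eleven orders below 100 ([pentagonal_orders]).
    On the p-torsion it bounds the order of that subgroup from below, so that Q
    is elementary at p when the p-part is 16 or 81 ([mulrn_torsion]). At the
    prime 5, a cyclic group of order 25 is excluded because the polynomial
    X^4 - X^3 + X^2 - X + 1 has no root modulo 25 ([mulrn5_of_card25]).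

    In all eleven cases Q is thus killed by a squarefree number, and a finite
    abelian group of squarefree exponent is determined by its order, since each
    of its Sylow subgroups is elementary abelian
    ([isomorphic_squarefree_exponent]).

    Conversely, the equation is solved by -1 on groups killed by 5, by a root of
    the polynomial modulo n on the other cyclic groups, and by the companion
    matrix on R^4; solutions pass to products and along isomorphisms. *)

Set Implicit Arguments.
Unset Strict Implicit.
Unset Printing Implicit Defensive.

Import GRing.Theory FinRing.Theory.
Local Open Scope group_scope.
Local Open Scope ring_scope.

(** * Endomorphisms that solve the pentagonal equation *)

HB.instance Definition _ (A B : finZmodType) := Finite.on (A * B)%type.

Definition has_pentagonal_endo (Q : zmodType) : Prop :=
  exists phi : {additive Q -> Q}, pentagonal_equation phi.

(** Turns a bare additive function into a witness, so that the constructions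
    below need not bundle their maps. *)
Lemma has_pentagonal_endo_fun (Q : zmodType) (f : Q -> Q) :
    zmod_morphism f ->
    (forall x, iter 4 f x - iter 3 f x + iter 2 f x - f x + x = 0) ->
  has_pentagonal_endo Q.
Proof.
move=> fB f_eq.
pose m := GRing.isZmodMorphism.Build Q Q f fB.
by exists (HB.pack_for {additive Q -> Q} f m).
Qed.

Section PentagonalEndomorphism.

Variables (Q : zmodType) (phi : {additive Q -> Q}).
Hypothesis phi_eq : pentagonal_equation phi.

(** The equation read as phi * (1 - phi + phi^2 - phi^3) = 1, which exhibits
    the inverse of phi. *)
Lemma phi_alternating_sum x :
  phi x - phi (phi x) + phi (phi (phi x)) - phi (phi (phi (phi x))) = x.
Proof.
have /eqP := phi_eq x; rewrite addrC addr_eq0 => /eqP x_eq.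
by rewrite [RHS]x_eq !opprD !opprK /= [RHS](ACl (4*3*2*1)).
Qed.

(** 1 + X^5 = (1 + X) * (X^4 - X^3 + X^2 - X + 1): add the alternating sums at
    x and at phi x. *)
Lemma phi5 x : iter 5 phi x = - x.
Proof.
have := congr1 (+%R x) (phi_alternating_sum (phi x)).
rewrite -{1}(phi_alternating_sum x) !addrA.
rewrite (ACl (1*8*(2*5)*(3*6)*(4*7))) /= !(addNr, subrr) !addr0.
by rewrite addrC => /addIr/(canRL opprK).
Qed.

Let delta x := x - phi x.
(* The inverse of 1 - phi, since
   (1 - phi) * (phi + phi^3) = phi - phi^2 + phi^3 - phi^4 = 1. *)
Let gamma x := phi x + phi (phi (phi x)).

Let deltaD : {morph delta : x y / x + y}.
Proof. by move=> x y; rewrite /delta raddfD opprD addrACA. Qed.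

Let delta_phi x : delta (phi x) = phi (delta x).
Proof. by rewrite /delta raddfB. Qed.

Let deltaK : cancel delta gamma.
Proof.
move=> x; rewrite /gamma /delta !raddfB /= -[RHS]phi_alternating_sum.
by rewrite !addrA.
Qed.

Let gammaK : cancel gamma delta.
Proof.
move=> x; rewrite /gamma /delta !raddfD /= -[RHS]phi_alternating_sum.
by rewrite (ACl (1*3*2*4)) /= !addrA.
Qed.

Lemma phi_bij : bijective phi.
Proof.
exists (fun x => x - phi x + phi (phi x) - phi (phi (phi x))) => x.
  exact: phi_alternating_sum.
by rewrite !(raddfB, raddfD) phi_alternating_sum.
Qed.

Lemma phi_regular : regular_automorphism phi.
Proof.
split=> [|x]; first exact: phi_bij.
split=> [fix_x|->]; last exact: raddf0.
by rewrite -[LHS]deltaK /delta fix_x subrr /gamma !raddf0 addr0.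
Qed.

(** The product is phi x + delta y with delta = 1 - phi. Solvability of
    x * y = z in either factor is bijectivity of delta and of phi, and mediality
    holds because phi and delta commute. For the last law, put y = x + e: each
    factor of the long product moves only the displacement from x, which
    becomes in turn delta e, phi (delta e), delta e + phi^2 (delta e), and
    phi (delta e) + phi^3 (delta e) = gamma (delta e) = e. *)
Lemma phi_pentagonal_quasigroup :
  pentagonal_quasigroup (fun x y => phi x + y - phi y).
Proof.
have opE x y : phi x + y - phi y = phi x + delta y by rewrite addrA.
have op_l x e : phi (x + e) + delta x = x + phi e.
  by rewrite raddfD (AC (2*2) (3*2*(1*4))) /= subrr addr0.
have op_r x d : phi x + delta (x + d) = x + delta d.
  by rewrite deltaD addrA /delta [phi x + _]addrC subrK.
have id x : phi x + delta x = x by rewrite addrC subrK.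
(* Otherwise additivity of phi would also rewrite inside delta. *)
clearbody delta.
have [psi phiK psiK] := phi_bij.
split=> [|x|x y z u|x y]; rewrite ?opE.
- split=> a b.
    exists (gamma (b - phi a)); split=> [|x <-]; rewrite opE.
      by rewrite gammaK addrC subrK.
    by rewrite [phi a + _]addrC addrK deltaK.
  exists (psi (b - delta a)); split=> [|x <-]; rewrite opE.
    by rewrite psiK subrK.
  by rewrite addrK phiK.
- exact: id.
- by rewrite !raddfD !deltaD !delta_phi addrACA.
have [e ->] : exists e, y = x + e by exists (y - x); rewrite addrC subrK.
rewrite op_r op_l [phi (x + _)]raddfD [phi x + _ + _]addrAC op_r -addrA op_l.
by rewrite -[in RHS](gammaK e) /gamma deltaD !delta_phi raddfD.
Qed.

End PentagonalEndomorphism.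

Lemma induces_pentagonal_quasigroupP (Q : zmodType) :
  induces_pentagonal_quasigroup Q <-> has_pentagonal_endo Q.
Proof.
split=> [[op [_ [phi [_ phi_eq _]]]]|[phi phi_eq]]; first by exists phi.
exists (fun x y => phi x + y - phi y); split.
  exact: phi_pentagonal_quasigroup.
by exists phi; split=> //; apply: phi_regular.
Qed.

(** * Counting fixed points of the automorphism - phi of order 5 *)

Section StableSubgroups.

Variables (Q : finZmodType) (phi : {additive Q -> Q}).
Hypothesis phi_eq : pentagonal_equation phi.

Let sigma x := - phi x.

Let sigma_inj : injective sigma.
Proof. by move=> x y /oppr_inj/(bij_inj (phi_bij phi_eq)). Qed.

Let sigma5 x : iter 5 sigma x = x.
Proof.
have sigma2 y : sigma (sigma y) = phi (phi y) by rewrite /sigma raddfN opprK.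
rewrite /= !sigma2 /sigma -[- phi x]raddfN.
by have /= -> := phi5 phi_eq (- x); rewrite opprK.
Qed.

(** On such an x the pentagonal equation reads 1 + 1 + 1 + 1 + 1 = 0. *)
Lemma fixed_mul5 x : phi x = - x -> x *+ 5 = 0.
Proof.
move=> phix; have phi2 : phi (phi x) = x by rewrite phix raddfN phix opprK.
rewrite -(phi_eq x) /= !phi2 phix !opprK.
by rewrite !mulrS mulr0n addr0 !addrA.
Qed.

(** The cyclic 5-group generated by sigma acts on S; its only fixed point is 0,
    as a fixed point is killed both by 5 and by the order of S. *)
Lemma card_stable_mod5 (S : {group Q}) :
    (forall x, x \in S -> phi x \in S) -> coprime 5 #|S| ->
  (#|S| %% 5 = 1)%N.
Proof.
move=> phiS co5S; pose s := perm sigma_inj.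
have s5 : (#[s] %| 5)%N.
  by rewrite order_dvdn; apply/eqP/permP=> x; rewrite permX perm1;
     rewrite (eq_iter (permE sigma_inj)) sigma5.
have s_grp : 5.-group <[s]> by apply: pnat_dvd s5 _.
have s_acts : [acts <[s]>, on S | 'P].
  rewrite cycle_subG !inE; apply/subsetP=> x Sx.
  rewrite !inE /= apermE permE /sigma.
  exact: groupVr (phiS x Sx).
rewrite (pgroup_fix_mod s_grp s_acts) afix_cycle.
suff -> : 'Fix_(S | 'P)[s] = [set 0] by rewrite cards1.
apply/setP=> x; rewrite !inE; apply/andP/eqP => [[Sx]|->].
  rewrite sub1set inE /= apermE permE => /eqP sx.
  have x5 : x *+ 5 = 0 by apply: fixed_mul5; rewrite -[in RHS]sx opprK.
  have : (#[x] %| gcdn 5 #|S|)%N.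
    by rewrite dvdn_gcd order_dvdG // order_dvdn zmodXgE x5 eqxx.
  by rewrite (eqP co5S) dvdn1 order_eq1 => /eqP.
split; first exact: group1.
by rewrite sub1set inE /= apermE permE /sigma raddf0 oppr0.
Qed.

(** The p-core of Q consists of its p-elements, so every endomorphism
    preserves it. *)
Lemma card_pcore_mod5 (p : nat) : p != 5%N -> (#|Q|`_p %% 5 = 1)%N.
Proof.
move=> pn5; have cQ := zmod_abelian [set: Q].
have hallP := nilpotent_pcore_Hall p (abelian_nil cQ).
have cardP := card_Hall hallP; rewrite cardsT in cardP; rewrite -cardP.
have memP x : (x \in 'O_p([set: Q])) = p.-elt x.
  by rewrite (mem_normal_Hall hallP) ?pcore_normal ?inE.
apply: card_stable_mod5 => [x|].
  rewrite !memP; apply: pnat_dvd.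
  rewrite order_dvdn zmodXgE -raddfMn -zmodXgE expg_order.
  by rewrite zmod1gE raddf0.
rewrite cardP coprime_sym (pnat_coprime (part_pnat p _)) //.
by rewrite pnatE // !inE eq_sym.
Qed.

(** Take for d the order of the p-torsion subgroup K: multiplication by
    #|Q| / d kills Q / K, hence maps Q into K, which p kills. When d is known to
    be large, this makes the exponent of Q small. *)
Lemma mulrn_torsion p : p \in \pi(#|Q|) -> p != 5%N ->
  exists2 d, [&& d %| #|Q|, 1 < d, p.-nat d & d %% 5 == 1]%N
    & forall x : Q, x *+ (#|Q| %/ d * p) = 0.
Proof.
rewrite mem_primes => /and3P[p_pr _ p_dvQ] pn5.
have cQ := zmod_abelian [set: Q].
pose K := Group (group_Ldiv p cQ).
have memK x : (x \in K) = (x *+ p == 0) by rewrite !inE zmodXgE.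
have abK : p.-abelem K.
  apply/abelemP=> //; split=> [|x]; first exact: zmod_abelian.
  by rewrite memK zmodXgE => /eqP.
have dvK : (#|K| %| #|Q|)%N by rewrite -cardsT cardSg ?subsetT.
have pK : p.-nat #|K| := abelem_pgroup abK.
exists #|K|.
  rewrite dvK pK cardG_gt1 /= andbC; apply/andP; split.
    apply/eqP; apply: (@card_stable_mod5 K) => [x|].
      by rewrite !memK -raddfMn => /eqP->; rewrite raddf0.
    by rewrite coprime_sym (pnat_coprime pK) // pnatE // !inE eq_sym.
  have [|x _ xp] := @Cauchy _ p [set: Q]%G p_pr; first by rewrite cardsT.
  apply/(@trivgPn _ K); exists x; last by rewrite -order_gt1 xp prime_gt1.
  by rewrite memK -zmodXgE -{1}xp expg_order.
move=> x; rewrite mulrnA; apply/eqP; rewrite -memK.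
have nK : K <| [set: Q] by rewrite -sub_abelian_normal ?subsetT.
rewrite -zmodXgE -cardsT divgS ?subsetT //.
have nx : x \in 'N(K) by apply: (subsetP (normal_norm nK)); rewrite inE.
apply: coset_idr; rewrite ?groupX // morphX //.
by rewrite -card_quotient ?normal_norm // expg_cardG ?mem_quotient ?inE.
Qed.

(** Otherwise phi acts on the cyclic group generated by x as multiplication by
    a root m of the polynomial modulo 25. There is none: modulo 5 the only root
    is -1, and the values at -1 + 5k are all 5 modulo 25. *)
Lemma no_order25 (x : Q) : #[x] = 25%N -> phi x \notin <[x]>.
Proof.
move=> ox; apply/negP=> /cyclePmin[m]; rewrite ox zmodXgE => m25 phix.
have iterE n : iter n phi x = x *+ (m ^ n).
  elim: n => [|n IHn]; first by rewrite mulr1n.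
  by rewrite iterS IHn raddfMn phix -mulrnA expnS.
have := phi_eq x; rewrite phix !iterE -[X in _ + X = 0]mulr1n.
rewrite (ACl (1*3*5*2*4)) /= -!addrA -opprD !addrA -!mulrnDr => /subr0_eq.
rewrite -!zmodXgE => /eqP; rewrite eq_expg_mod_order ox.
have : all (fun m => m ^ 4 + m ^ 2 + 1 != m ^ 3 + m %[mod 25])%N
  (iota 0 25) by vm_compute.
by move=> /allP/(_ m); rewrite mem_iota => /(_ m25) /negPf ->.
Qed.

Lemma mulrn5_of_card25 : #|Q| = 25%N -> forall x : Q, x *+ 5 = 0.
Proof.
move=> cQ x; apply/eqP; apply: contraT => x5.
have /(dvdn_pfactor _ 2)[//|[|[|[|//]]] _ ox]: (#[x] %| 5 ^ 2)%N.
- by rewrite -[(5 ^ 2)%N]cQ -cardsT order_dvdG ?inE.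
- by move: x5; rewrite -zmodXgE -order_dvdn ox.
- by move: x5; rewrite -zmodXgE -order_dvdn ox.
have /negP[] := no_order25 ox.
suff -> : <[x]> = [set: Q] by rewrite inE.
by apply/eqP; rewrite eqEcard subsetT cardsT cQ -orderE ox.
Qed.

(** Every prime p <> 5 contributes a power of p that is 1 modulo 5; the rest is
    a finite check. *)
Lemma pentagonal_orders : (1 < #|Q| < 100)%N ->
  #|Q| \in [:: 5; 11; 16; 25; 31; 41; 55; 61; 71; 80; 81]%N.
Proof.
pose ok (n p : nat) := ((p == 5) || (p ^ logn p n %% 5 == 1))%N.
have cert : all (fun n => all (ok n) (primes n) ==>
    (n \in [:: 5; 11; 16; 25; 31; 41; 55; 61; 71; 80; 81]%N)) (iota 2 98).
  by vm_compute.
move=> bnd; apply: (implyP (allP cert _ _)); first by rewrite mem_iota.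
apply/allP=> p _; rewrite /ok; have [//|pn5 /=] := eqVneq p 5%N.
by rewrite -p_part card_pcore_mod5.
Qed.

End StableSubgroups.

(** * Abelian groups of squarefree exponent *)

(** The Sylow p-subgroups of both groups are elementary abelian of equal order,
    hence isomorphic; split off one prime at a time, by induction on the
    order. *)
Lemma isog_squarefree_exponent m (aT rT : finGroupType)
    (G : {group aT}) (H : {group rT}) :
    (0 < m)%N -> all (fun p => logn p m <= 1)%N (primes m) ->
    abelian G -> abelian H -> #|G| = #|H| ->
    (exponent G %| m)%N -> (exponent H %| m)%N ->
  G \isog H.
Proof.
move=> m_gt0 sqf_m.
have logm p : (logn p m <= 1)%N.
  have [/(allP sqf_m)//|] := boolP (p \in primes m).
  by rewrite -logn_gt0 lt0n negbK => /eqP->.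
have pcore_abelem p (gT : finGroupType) (K : {group gT}) :
    prime p -> abelian K -> (exponent K %| m)%N -> p.-abelem 'O_p(K).
  move=> p_pr cK expK; apply/abelemP => //; split=> [|x Kx].
    exact: abelianS (pcore_sub _ _) cK.
  apply/eqP; rewrite -order_dvdn.
  have /p_natP[k ok] : p.-elt x := mem_p_elt (pcore_pgroup _ _) Kx.
  rewrite ok -{2}[p]expn1 dvdn_Pexp2l ?prime_gt1 //; apply: leq_trans (logm p).
  rewrite -pfactor_dvdn // -ok; apply: dvdn_trans expK.
  exact/dvdn_exponent/(subsetP (pcore_sub _ _) _ Kx).
have [n] := ubnP #|G|; elim: n => // n IHn in aT rT G H *.
rewrite ltnS => leGn cG cH eqGH expG expH.
have [G1|ntG] := eqVneq #|G| 1%N.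
  have H1 : #|H| = 1%N by rewrite -eqGH.
  exact: trivial_isog (card1_trivg G1) (card1_trivg H1).
have G_gt1 : (1 < #|G|)%N by rewrite ltn_neqAle eq_sym ntG cardG_gt0.
pose p := pdiv #|G|; have p_pr : prime p by apply: pdiv_prime.
have card_pcore pi (gT : finGroupType) (K : {group gT}) :
    abelian K -> #|'O_pi(K)| = (#|K|`_pi)%N.
  by move=> cK; apply: card_Hall (nilpotent_pcore_Hall _ (abelian_nil cK)).
have pG := pcore_abelem _ _ _ p_pr cG expG.
have pH := pcore_abelem _ _ _ p_pr cH expH.
apply: isog_dprod (nilpotent_pcoreC p (abelian_nil cG))
  (nilpotent_pcoreC p (abelian_nil cH)) _ _.
  by rewrite (isog_abelem_card _ pG) pH !card_pcore ?eqGH /=.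
apply: IHn.
- rewrite card_pcore //; apply: leq_trans leGn.
  rewrite -[ltnRHS](partnC p) // ltn_Pmull ?part_gt0 // p_part_gt1.
  by rewrite mem_primes p_pr cardG_gt0 pdiv_dvd.
- exact: abelianS (pcore_sub _ _) cG.
- exact: abelianS (pcore_sub _ _) cH.
- by rewrite !card_pcore ?eqGH.
- exact: dvdn_trans (exponentS (pcore_sub _ _)) expG.
- exact: dvdn_trans (exponentS (pcore_sub _ _)) expH.
Qed.

Lemma isomorphic_squarefree_exponent m (Q R : finZmodType) :
    (0 < m)%N -> all (fun p => logn p m <= 1)%N (primes m) -> #|Q| = #|R| ->
    (forall x : Q, x *+ m = 0) -> (forall x : R, x *+ m = 0) ->
  isomorphic Q R.
Proof.
move=> m_gt0 sqf_m cardQR mQ mR.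
have /isogP[f f_inj _] : [set: Q] \isog [set: R].
  apply: (isog_squarefree_exponent m_gt0 sqf_m);
    rewrite ?zmod_abelian ?cardsT //.
    by apply/exponentP=> x _; apply: mQ.
  by apply/exponentP=> x _; apply: mR.
have fB : zmod_morphism f.
  by move=> x y; rewrite -!zmodVgE -!zmodMgE morphM ?inE // morphV ?inE.
pose fm := GRing.isZmodMorphism.Build Q R f fB.
exists (HB.pack_for {additive Q -> R} (f : Q -> R) fm).
apply: inj_card_bij; last by rewrite cardQR.
by move=> x y; apply: (injmP f_inj); rewrite inE.
Qed.

(** * Constructing solutions *)

Lemma isomorphic_card (Q R : finZmodType) : isomorphic Q R -> #|Q| = #|R|.
Proof. by case=> f /bij_eq_card. Qed.

Lemma isomorphic_pentagonal_endo (Q R : zmodType) :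
  isomorphic Q R -> has_pentagonal_endo R -> has_pentagonal_endo Q.
Proof.
case=> f [g fK gK] [phi phi_eq].
have gB : zmod_morphism g by apply: can2_zmod_morphism fK gK.
apply: (@has_pentagonal_endo_fun Q (g \o phi \o f)) => [x y|x] /=.
  by rewrite !(raddfB, gB).
by rewrite !gK; apply: (can_inj fK); rewrite !(raddfB, raddfD) !gK phi_eq raddf0.
Qed.

(** Take phi = -1, whose value in the polynomial is 5. *)
Lemma pentagonal_endo_mul5 (Q : zmodType) :
  (forall x : Q, x *+ 5 = 0) -> has_pentagonal_endo Q.
Proof.
move=> Q5; apply: (@has_pentagonal_endo_fun Q -%R) => [x y|x] /=.
  by rewrite opprD.
by rewrite !opprK -[RHS](Q5 x) !mulrS mulr0n addr0 !addrA.
Qed.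

Lemma pentagonal_endo_scalar (R : comPzRingType) (c : R) :
  c ^+ 4 - c ^+ 3 + c ^+ 2 - c + 1 = 0 -> has_pentagonal_endo R.
Proof.
move=> c_eq; apply: (@has_pentagonal_endo_fun R ( *%R c)) => [x y|x].
  by rewrite mulrBr.
rewrite -[RHS](mul0r x) -c_eq !(mulrDl, mulNr) mul1r /=.
by rewrite !exprS expr0 mulr1 !mulrA.
Qed.

(** Multiplication by X on R[X] / (X^4 - X^3 + X^2 - X + 1), in the basis
    1, X, X^2, X^3, where X^4 = X^3 - X^2 + X - 1. *)
Lemma pentagonal_endo_companion (R : comNzRingType) :
  has_pentagonal_endo 'rV[R]_4.
Proof.
pose f (v : 'rV[R]_4) := \row_(j < 4)
  [:: - v 0 3; v 0 0 + v 0 3; v 0 1 - v 0 3; v 0 2 + v 0 3]`_j.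
have f0 v : f v 0 0 = - v 0 3 by rewrite mxE.
have f1 v : f v 0 1 = v 0 0 + v 0 3 by rewrite mxE.
have f2 v : f v 0 2 = v 0 1 - v 0 3 by rewrite mxE.
have f3 v : f v 0 3 = v 0 2 + v 0 3 by rewrite mxE.
have row4P (u v : 'rV[R]_4) : u 0 0 = v 0 0 -> u 0 1 = v 0 1 ->
    u 0 2 = v 0 2 -> u 0 3 = v 0 3 -> u = v.
  move=> e0 e1 e2 e3; apply/rowP=> -[[|[|[|[|//]]]] j4].
  - by have -> : Ordinal j4 = 0 by apply: val_inj.
  - by have -> : Ordinal j4 = 1 by apply: val_inj.
  - by have -> : Ordinal j4 = 2 by apply: val_inj.
  - by have -> : Ordinal j4 = 3 by apply: val_inj.
have addE (u v : 'rV[R]_4) j : (u + v) 0 j = u 0 j + v 0 j by rewrite mxE.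
have oppE (u : 'rV[R]_4) j : (- u) 0 j = - u 0 j by rewrite mxE.
apply: (@has_pentagonal_endo_fun _ f) => [x y|x]; apply: row4P;
  rewrite ?[iter _ _ _]/= !(addE, oppE, f0, f1, f2, f3) ?[(0 : 'rV_4) _ _]mxE;
  ring.
Qed.

Lemma pentagonal_endo_prod (Q R : zmodType) :
  has_pentagonal_endo Q -> has_pentagonal_endo R ->
  has_pentagonal_endo (Q * R)%type.
Proof.
move=> [phi phi_eq] [psi psi_eq].
apply: (@has_pentagonal_endo_fun _ (fun u => (phi u.1, psi u.2))) => [x y|[x y]].
  by rewrite !raddfB.
by congr pair; [apply: phi_eq | apply: psi_eq].
Qed.

Lemma mulrn_Zp n (x : 'Z_n) : (1 < n)%N -> x *+ n = 0.
Proof. by move=> n1; rewrite -mulr_natr pchar_Zp // mulr0. Qed.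

Lemma mulrn_rV p k (x : 'rV['Z_p]_k) : (1 < p)%N -> x *+ p = 0.
Proof. by move=> p1; apply/rowP=> i; rewrite mulmxnE mxE mulrn_Zp. Qed.

(** * The classification below order 100 *)

Theorem theorem5p1 (Q : finZmodType) :
  ((1 < #|Q| < 100)%N /\ induces_pentagonal_quasigroup Q) <->
  (isomorphic Q 'Z_5 \/
   isomorphic Q 'Z_11 \/
   isomorphic Q 'rV['Z_2]_4 \/
   isomorphic Q 'rV['Z_5]_2 \/
   isomorphic Q 'Z_31 \/
   isomorphic Q 'Z_41 \/
   isomorphic Q 'Z_55 \/
   isomorphic Q 'Z_61 \/
   isomorphic Q 'Z_71 \/
   isomorphic Q ('rV['Z_2]_4 * 'Z_5)%type \/
   isomorphic Q 'rV['Z_3]_4).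
Proof.
rewrite induces_pentagonal_quasigroupP.
have card_Zp n : (1 < n)%N -> #|'Z_n| = n by move=> n1; rewrite card_ord Zp_cast.
have card_rV p k : (1 < p)%N -> #|{: 'rV['Z_p]_k}| = (p ^ k)%N.
  by move=> p1; rewrite card_mx card_Zp // mul1n.
split=> [[bnd [phi phi_eq]]|].
  have mulQ (x : Q) : x *+ #|Q| = 0.
    by rewrite -zmodXgE -cardsT expg_cardG ?inE.
  have cyclicQ n : (1 < n)%N -> all (fun p => logn p n <= 1)%N (primes n) ->
      #|Q| = n -> isomorphic Q 'Z_n.
    move=> n1 sqf_n cQ; apply: (isomorphic_squarefree_exponent (ltnW n1) sqf_n).
    - by rewrite card_Zp.
    - by rewrite -cQ.
    - by move=> x; apply: mulrn_Zp.
  (* The divisibility and congruence constraints are to leave d as the only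
     possible order of the p-torsion subgroup: 16 for p = 2, 81 for p = 3. *)
  have exp_p p d : p \in primes #|Q| -> p != 5%N ->
      all (fun e => [&& 1 < e, p.-nat e & e %% 5 == 1] ==> (e == d))%N
        (divisors #|Q|) ->
      forall x : Q, x *+ (#|Q| %/ d * p) = 0.
    move=> pQ pn5 /allP uniq_d.
    have [e /and4P[e_dv e1 pe e5] eQ] := mulrn_torsion phi_eq pQ pn5.
    have := uniq_d e; rewrite -dvdn_divisors ?(ltnW (andP bnd).1) //.
    by move=> /(_ e_dv); rewrite e1 pe e5 => /eqP <-.
  have := pentagonal_orders phi_eq bnd; rewrite !inE.
  do 10?[case/orP]; move/eqP=> cQ.
  - by left; apply: cyclicQ.
  - by right; left; apply: cyclicQ.
  - do 2 right; left; apply: (@isomorphic_squarefree_exponent 2) => //.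
    + by rewrite card_rV.
    + by move: (exp_p 2 16); rewrite cQ; apply.
    + by move=> x; apply: mulrn_rV.
  - do 3 right; left; apply: (@isomorphic_squarefree_exponent 5) => //.
    + by rewrite card_rV.
    + exact: mulrn5_of_card25 phi_eq cQ.
    + by move=> x; apply: mulrn_rV.
  - by do 4 right; left; apply: cyclicQ.
  - by do 5 right; left; apply: cyclicQ.
  - by do 6 right; left; apply: cyclicQ.
  - by do 7 right; left; apply: cyclicQ.
  - by do 8 right; left; apply: cyclicQ.
  - do 9 right; left; apply: (@isomorphic_squarefree_exponent 10) => //.
    + by rewrite card_prod card_rV // card_Zp.
    + by move: (exp_p 2 16); rewrite cQ; apply.
    + move=> [u c]; have -> : (u, c) *+ 10 = (u *+ (2 * 5), c *+ (5 * 2)) by [].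
      by rewrite !mulrnA mulrn_rV // mulrn_Zp // !mul0rn.
  - do 10 right; apply: (@isomorphic_squarefree_exponent 3) => //.
    + by rewrite card_rV.
    + by move: (exp_p 3 81); rewrite cQ; apply.
    + by move=> x; apply: mulrn_rV.
have transfer (R : finZmodType) : (1 < #|R| < 100)%N -> has_pentagonal_endo R ->
    isomorphic Q R -> (1 < #|Q| < 100)%N /\ has_pentagonal_endo Q.
  move=> bndR endoR isoQR; rewrite (isomorphic_card isoQR); split=> //.
  exact: isomorphic_pentagonal_endo isoQR endoR.
have endo_Z5 : has_pentagonal_endo 'Z_5.
  by apply: pentagonal_endo_mul5 => x; apply: mulrn_Zp.
have scalar n c : (c ^+ 4 - c ^+ 3 + c ^+ 2 - c + 1 == 0 :> 'Z_n) ->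
    has_pentagonal_endo 'Z_n.
  by move/eqP; apply: pentagonal_endo_scalar.
case=> [|[|[|[|[|[|[|[|[|[|]]]]]]]]]].
- by apply: (transfer 'Z_5); rewrite ?card_Zp.
- by apply: (transfer 'Z_11); rewrite ?card_Zp //; apply: (scalar 11 2).
- by apply: (transfer 'rV['Z_2]_4); rewrite ?card_rV //;
    apply: pentagonal_endo_companion.
- apply: (transfer 'rV['Z_5]_2); rewrite ?card_rV //.
  apply: pentagonal_endo_mul5 => x.
  exact: mulrn_rV.
- by apply: (transfer 'Z_31); rewrite ?card_Zp //; apply: (scalar 31 15).
- by apply: (transfer 'Z_41); rewrite ?card_Zp //; apply: (scalar 41 4).
- by apply: (transfer 'Z_55); rewrite ?card_Zp //; apply: (scalar 55 24).
- by apply: (transfer 'Z_61); rewrite ?card_Zp //; apply: (scalar 61 3).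
- by apply: (transfer 'Z_71); rewrite ?card_Zp //; apply: (scalar 71 14).
- apply: (transfer ('rV['Z_2]_4 * 'Z_5)%type).
    by rewrite card_prod card_rV // card_Zp.
  exact: pentagonal_endo_prod (pentagonal_endo_companion _) endo_Z5.
- by apply: (transfer 'rV['Z_3]_4); rewrite ?card_rV //;
    apply: pentagonal_endo_companion.
Qed.
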